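(* For every typing context $\Gamma$, formula $A$ and term $u$ such that $\Gamma\vdash_{\mathtt{NI}^p}u:A$: (1) $\Gamma^*\vdash_{\mathtt{NI}^2_{at}}u^{*\downarrow}\rightsquigarrow_{\beta}u^{*\downarrow^{\varepsilon}}:A^*$; (2) $\Gamma^*\vdash_{\mathtt{NI}^2_{at}}u^{*\downarrow^{\varepsilon}}\rightsquigarrow_{\beta}u^{\sharp}:A^*$. Here $u^{*\downarrow}$ is the FF-atomization of the RP-translation of $u$, $u^{*\downarrow^\varepsilon}$ the $\varepsilon$-atomization of the RP-translation of $u$, and $u^\sharp$ the ESF-translation of $u$.
   Context: Notation for lists: for a finite (possibly empty) list $\mathcal A=\langle a_1,\dots,a_n\rangle$, $\langle A_a\rangle_{a\in\mathcal A}\supset B$ abbreviates $A_{a_1}\supset\dots\supset A_{a_n}\supset B$ (just $B$ if $\mathcal A$ is empty); $\lambda\langle x_a\rangle.t$ abbreviates $\lambda x_{a_1}\dots\lambda x_{a_n}.t$ and $t\langle u_a\rangle$ abbreviates $t\,u_{a_1}\cdots u_{a_n}$. Polynomial connectives. A polynomial connective $\dagger$ is given by finite (possibly empty) lists $\mathcal I,\mathcal J,\mathcal K$ and functions $f:\mathcal J\to\mathcal I$, $g:\mathcal J\to\mathcal K$; $g^{-1}(k)$ is the sublist of the $j\in\mathcal J$ with $g(j)=k$. It forms a formula $\dagger\langle A_i\rangle_{i\in\mathcal I}$. Formulas. $\mathcal L^p$: $A::=X\mid A\supset B\mid\dagger\langle A_i\rangle$; $\mathcal L^2$: $A::=X\mid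 A\supset B\mid\forall X.A$. $\mathcal L^2_{RP}\subset\mathcal L^2$: $A::=X\mid A\supset B\mid\forall X.\langle\langle A_{f(j)}\rangle_{j\in g^{-1}(k)}\supset X\rangle_{k\in\mathcal K}\supset X$ ($X$ not free in the $A_i$). System $\mathtt{NI}^p$ over $\mathcal L^p$: terms $t::=x\mid\lambda x.t\mid tu\mid\iota_\dagger^k\langle t_j\rangle_{j\in g^{-1}(k)}\mid\delta_\dagger(t,\langle\langle y_j\rangle_{j\in g^{-1}(k)}.s_k\rangle_{k\in\mathcal K})$, with the usual rules for variables, $\lambda$ and application, and: for each $k\in\mathcal K$, from $\Gamma\vdash t_j:A_{f(j)}$ for all $j\in g^{-1}(k)$ infer $\Gamma\vdash\iota_\dagger^k\langle t_j\rangle:\dagger\langle A_i\rangle$; from $\Gamma\vdash t:\dagger\langle A_i\rangle$ and $\Gamma,\langle y_j:A_{f(j)}\rangle_{j\in g^{-1}(k)}\vdash s_k:C$ for all $k\in\mathcal K$ infer $\Gamma\vdash\delta_\dagger(t,\langle\langle y_j\rangle.s_k\rangle_k):C$. System $\mathtt{NI}^2$ over $\mathcal L^2$ is System F (terms $x,\lambda x.t,tu,\Lambda X.t,tB$): from $\Gamma\vdash t:A$, $X\notin FV(\Gamma)$ infer $\Gamma\vdash\Lambda X.t:\forall X.A$; from $\Gamma\vdash t:\forall X.A$ infer $\Gamma\vdash tB:A\llbracket B/X\rrbracket$. $\mathtt{NI}^2_{RP}$ is its restriction to $\mathcal L^2_{RP}$-formulas. $\mathtt{NI}^2_{at}$ is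 $\mathtt{NI}^2$ with type application restricted to $tY$ with $Y$ a variable. Terms represent derivations; type information is regarded as part of the term, though not displayed, and the translations are defined by recursion on typing derivations. Reduction. $\Gamma\vdash_{\mathtt{NI}^2_{at}}t\rightsquigarrow_\beta s:A$: derivable by reflexivity, transitivity, congruence and the left-to-right rules $(\lambda x.t)s\rightsquigarrow t\llbracket s/x\rrbracket$, $(\Lambda X.t)Y\rightsquigarrow t\llbracket Y/X\rrbracket$ (multi-step reduction). Contexts. A term context has a hole $[\ ]$; $\mathtt U[t]$ is capture-avoiding, $\mathtt U\{t\}$ variable-capturing, substitution for the hole. $\mathsf{at}(B)$ is the rightmost variable of $B\in\mathcal L^2$. $\mathtt{El}_B,\mathtt{In}_B$ are defined with the same fresh variables in both: $\mathtt{El}_Z=\mathtt{In}_Z=[\ ]$ for $Z$ a variable; $\mathtt{El}_{C\supset D}=\mathtt{El}_D[[\ ]x]$, $\mathtt{In}_{C\supset D}=\lambda x.\mathtt{In}_D$; $\mathtt{El}_{\forall X.D}=\mathtt{El}_D[[\ ]X]$, $\mathtt{In}_{\forall X.D}=\Lambda X.\mathtt{In}_D$. (If the rightmost variable is bound in $B$, $\mathsf{at}(B)$ denotes the corresponding type variable used in $\mathtt{El}_B,\mathtt{In}_B$.) RP-translation. $X^*=X$, $(A\supset B)^*=A^*\supset B^*$, $(\dagger\langle A_i\rangle)^*=\forall X.\langle\langle A_{f(j)}^*\rangle_{j\in g^{-1}(k)}\supset X\rangle_{k\in\mathcal K}\supset X$ ($X$ not free in any $A_i$); $\Gamma^*$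 is obtained by translating all types in $\Gamma$. On terms with $\Gamma\vdash_{\mathtt{NI}^p}u:A$: $x^*=x$, $(\lambda x.t)^*=\lambda x.t^*$, $(ts)^*=t^*s^*$, $(\iota_\dagger^{k_0}\langle t_j\rangle)^*=\Lambda X.\lambda\langle x_k\rangle_{k\in\mathcal K}.x_{k_0}\langle t_j^*\rangle$, and for $\delta_\dagger(t,\langle\langle y_j\rangle.s_k\rangle):A$, $(\delta_\dagger(t,\langle\langle y_j\rangle.s_k\rangle))^*=t^*A^*\langle\lambda\langle y_j\rangle.s_k^*\rangle_{k\in\mathcal K}$. The result is an $\mathtt{NI}^2_{RP}$-term of type $A^*$ in context $\Gamma^*$. FF-atomization $(\cdot)^\downarrow$ and $\varepsilon$-atomization $(\cdot)^{\downarrow^\varepsilon}$ are defined on $\mathtt{NI}^2_{RP}$-terms. For $\natural\in\{\downarrow,\downarrow^\varepsilon\}$: $x^\natural=x$, $(\lambda x.t)^\natural=\lambda x.t^\natural$, $(ts)^\natural=t^\natural s^\natural$, $(\Lambda X.t)^\natural=\Lambda X.t^\natural$, $(tY)^\natural=t^\natural Y$ for $Y$ a variable. For $t:\forall X.\langle\langle A_{f(j)}\rangle_{j\in g^{-1}(k)}\supset X\rangle_{k\in\mathcal K}\supset X$: $(t(C\supset D))^\downarrow=\lambda\langle y_k\rangle_{k\in\mathcal K}.\lambda x.(tD)^\downarrow\langle\lambda\langle z_j\rangle_{j\in g^{-1}(k)}.y_k\langle z_j\rangle x\rangle_{k\in\mathcal K}$; $(t(\forall X.D))^\downarrow=\lambda\langle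 y_k\rangle_{k\in\mathcal K}.\Lambda X.(tD)^\downarrow\langle\lambda\langle z_j\rangle_{j\in g^{-1}(k)}.y_k\langle z_j\rangle X\rangle_{k\in\mathcal K}$; and, for $B$ not atomic and $Z=\mathsf{at}(B)$, $(tB)^{\downarrow^\varepsilon}=\lambda\langle y_k\rangle_{k\in\mathcal K}.\mathtt{In}_B\{t^{\downarrow^\varepsilon}Z\langle\lambda\langle w_j\rangle_{j\in g^{-1}(k)}.\mathtt{El}_B[y_k\langle w_j\rangle]\rangle_{k\in\mathcal K}\}$. ESF-translation $(\cdot)^\sharp$ on $\mathtt{NI}^p$-terms: $x^\sharp=x$, $(\lambda x.t)^\sharp=\lambda x.t^\sharp$, $(ts)^\sharp=t^\sharp s^\sharp$, $(\iota_\dagger^{k_0}\langle t_j\rangle)^\sharp=\Lambda X.\lambda\langle x_k\rangle_{k\in\mathcal K}.x_{k_0}\langle t_j^\sharp\rangle$, and for $\delta_\dagger(t,\langle\langle y_j\rangle.s_k\rangle):A$ with $Z=\mathsf{at}(A^* )$, $(\delta_\dagger(t,\langle\langle y_j\rangle.s_k\rangle))^\sharp=\mathtt{In}_{A^*}\{t^\sharp Z\langle\lambda\langle y_j\rangle.\mathtt{El}_{A^*}[s_k^\sharp]\rangle_{k\in\mathcal K}\}$. *)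

(* Defs.v *)
From mathcomp Require Import all_boot.

Set Implicit Arguments.
Unset Strict Implicit.
Unset Printing Implicit Defensive.

(* Binders are represented by de Bruijn indices, with separate index spaces for
   type variables and term variables.  The head of a typing context is the type
   of term variable 0, so that a context extended by <y_1 : A_1, .., y_m : A_m>
   is [rev As ++ G].  Terms are Church-style: enough type information is
   recorded in a term to determine its typing derivation in a given context. *)

(** * Polynomial connectives and the language L^p *)

Record connective := Connective {
  nI : nat;
  nJ : nat;
  nK : nat;
  cf : {ffun 'I_nJ -> 'I_nI};
  cg : {ffun 'I_nJ -> 'I_nK} }.

Notation fiber c k := {j : 'I_(nJ c) | cg c j == k}.

Inductive form :=
| PVar of nat
| PImp of form & form
| PCon (c : connective) of {ffun 'I_(nI c) -> form}.

(* << F (f j) >>_{j in g^-1(k)}, and the list of these lists for k in K. *)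
Definition row (T : Type) (c : connective) (F : 'I_(nI c) -> T) (k : 'I_(nK c)) :
  seq T := [seq F (cf c (val j)) | j : fiber c k].

Definition matrix (T : Type) (c : connective) (F : 'I_(nI c) -> T) :
  seq (seq T) := [seq row F k | k : 'I_(nK c)].

(** * System NI^p *)

(* [PIota k A t] is the k-th introduction at type [PCon c A]; [PDelta A C t s]
   is the elimination of [t : PCon c A] into the type [C], where [s k] binds
   one variable for each j in g^-1(k), the last one having index 0. *)
Inductive pterm :=
| PV of nat
| PLam of form & pterm
| PApp of pterm & pterm
| PIota (c : connective) (k : 'I_(nK c)) of
    {ffun 'I_(nI c) -> form} & {ffun fiber c k -> pterm}
| PDelta (c : connective) of
    {ffun 'I_(nI c) -> form} & form & pterm & {ffun 'I_(nK c) -> pterm}.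

Inductive ptyping : seq form -> pterm -> form -> Prop :=
| pt_var G n A :
    onth G n = Some A -> ptyping G (PV n) A
| pt_lam G A B t :
    ptyping (A :: G) t B -> ptyping G (PLam A t) (PImp A B)
| pt_app G A B t u :
    ptyping G t (PImp A B) -> ptyping G u A -> ptyping G (PApp t u) B
| pt_iota G c (k : 'I_(nK c)) (A : {ffun 'I_(nI c) -> form})
    (t : {ffun fiber c k -> pterm}) :
    (forall j : fiber c k, ptyping G (t j) (A (cf c (val j)))) ->
    ptyping G (PIota A t) (PCon A)
| pt_delta G c (A : {ffun 'I_(nI c) -> form}) C t
    (s : {ffun 'I_(nK c) -> pterm}) :
    ptyping G t (PCon A) ->
    (forall k : 'I_(nK c), ptyping (rev (row A k) ++ G) (s k) C) ->
    ptyping G (PDelta A C t s) C.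

(** * The language L^2 and the terms of System F *)

Inductive ty :=
| TVar of nat
| Arr of ty & ty
| All of ty.

Definition scons (T : Type) (a : T) (s : nat -> T) (n : nat) : T :=
  if n is n'.+1 then s n' else a.

Definition upr (r : nat -> nat) : nat -> nat := scons 0 (fun n => (r n).+1).

Fixpoint tren (r : nat -> nat) (A : ty) : ty :=
  match A with
  | TVar n => TVar (r n)
  | Arr A B => Arr (tren r A) (tren r B)
  | All A => All (tren (upr r) A)
  end.

(* [tshift d A] is [A] seen in the scope of [d] further type variables. *)
Definition tshift (d : nat) : ty -> ty := tren (addn d).

(* [TApp t T B] is the type application t B, where [t : All T]. *)
Inductive tm :=
| Var of nat
| Lam of ty & tm
| App of tm & tm
| TLam of tm
| TApp of tm & ty & ty.

Fixpoint rent (r : nat -> nat) (t : tm) : tm :=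
  match t with
  | Var n => Var n
  | Lam A t => Lam (tren r A) (rent r t)
  | App t u => App (rent r t) (rent r u)
  | TLam t => TLam (rent (upr r) t)
  | TApp t T B => TApp (rent r t) (tren (upr r) T) (tren r B)
  end.

Fixpoint ren (r : nat -> nat) (t : tm) : tm :=
  match t with
  | Var n => Var (r n)
  | Lam A t => Lam A (ren (upr r) t)
  | App t u => App (ren r t) (ren r u)
  | TLam t => TLam (ren r t)
  | TApp t T B => TApp (ren r t) T B
  end.

Fixpoint subst (s : nat -> tm) (t : tm) : tm :=
  match t with
  | Var n => s n
  | Lam A t => Lam A (subst (scons (Var 0) (fun n => ren succn (s n))) t)
  | App t u => App (subst s t) (subst s u)
  | TLam t => TLam (subst (fun n => rent succn (s n)) t)
  | TApp t T B => TApp (subst s t) T B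
  end.

Definition subst1 (u t : tm) : tm := subst (scons u Var) t.

(* Substitution of the type variable Y for type variable 0; as type arguments
   are variables in NI^2_at, no other type substitution is needed there. *)
Definition tinst (Y : nat) : ty -> ty := tren (scons Y id).
Definition tinst_tm (Y : nat) : tm -> tm := rent (scons Y id).

(** * System NI^2_at and its beta-reduction *)

Inductive typing : seq ty -> tm -> ty -> Prop :=
| t_var G n A :
    onth G n = Some A -> typing G (Var n) A
| t_lam G A B t :
    typing (A :: G) t B -> typing G (Lam A t) (Arr A B)
| t_app G A B t u :
    typing G t (Arr A B) -> typing G u A -> typing G (App t u) B
| t_tlam G A t :
    typing (map (tshift 1) G) t A -> typing G (TLam t) (All A)
| t_tapp G A t Y :
    typing G t (All A) -> typing G (TApp t A (TVar Y)) (tinst Y A).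

Inductive red : seq ty -> tm -> tm -> ty -> Prop :=
| r_refl G t A :
    typing G t A -> red G t t A
| r_trans G t u v A :
    red G t u A -> red G u v A -> red G t v A
| r_lam G A B t t' :
    red (A :: G) t t' B -> red G (Lam A t) (Lam A t') (Arr A B)
| r_app G A B t t' u u' :
    red G t t' (Arr A B) -> red G u u' A -> red G (App t u) (App t' u') B
| r_tlam G A t t' :
    red (map (tshift 1) G) t t' A -> red G (TLam t) (TLam t') (All A)
| r_tapp G A t t' Y :
    red G t t' (All A) ->
    red G (TApp t A (TVar Y)) (TApp t' A (TVar Y)) (tinst Y A)
| r_beta G A B t u :
    typing (A :: G) t B -> typing G u A ->
    red G (App (Lam A t) u) (subst1 u t) B
| r_tbeta G A t Y :
    typing (map (tshift 1) G) t A ->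
    red G (TApp (TLam t) A (TVar Y)) (tinst_tm Y t) (tinst Y A).

(** * Iterated constructions *)

Definition arrs (As : seq ty) (B : ty) : ty := foldr Arr B As.
Definition lams (As : seq ty) (t : tm) : tm := foldr Lam t As.
Definition apps (t : tm) (us : seq tm) : tm := foldl App t us.

(* Under [lams As], with [m = size As], the i-th bound variable (counting from
   0, outermost first) is [bvar m i]; [bvars m] lists them all in order. *)
Definition bvar (m i : nat) : tm := Var (m - i.+1).
Definition bvars (m : nat) : seq tm := mkseq (bvar m) m.

(* Weaken a term by [d] term and [e] type variables, keeping fixed its [m]
   innermost term variables. *)
Definition weaken (m d e : nat) (t : tm) : tm :=
  ren (fun i => if i < m then i else d + i) (rent (addn e) t).

(* For M = <<A_j>_{j in g^-1(k)}>_k, the formula of L^2_RP determined by M is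
   [All (rp_body M)].  The entries of M live outside the scope of the bound
   variable, whence the shift. *)
Definition rp_body (M : seq (seq ty)) : ty :=
  arrs [seq arrs (map (tshift 1) As) (TVar 0) | As <- M] (TVar 0).

Fixpoint doms (A : ty) : seq ty :=
  if A is Arr A1 A2 then A1 :: doms A2 else [::].

Definition rp_matrix (T : ty) : seq (seq ty) :=
  [seq map (tren predn) (doms P) | P <- doms T].

(* The matrix of a formula of L^2_RP can be read off from the formula. *)
Lemma rp_bodyK : cancel rp_body rp_matrix.
Proof.
have domsE As n : doms (arrs As (TVar n)) = As by elim: As => //= A As ->.
have upE r r' : cancel r r' -> cancel (upr r) (upr r').
  by move=> K [|n] //=; rewrite K.
have trenK (A : ty) r r' : cancel r r' -> tren r' (tren r A) = A.
  elim: A r r' => [n|A IHA B IHB|A IHA] r r' K /=; first by rewrite K.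
    by rewrite IHA ?IHB.
  by rewrite IHA //; apply: upE.
move=> M; rewrite /rp_matrix /rp_body domsE -map_comp -[RHS]map_id.
apply: eq_map => As /=; rewrite domsE -map_comp -[RHS]map_id.
by apply: eq_map => A /=; apply: trenK.
Qed.

(** * The RP-translation *)

Fixpoint star (A : form) : ty :=
  match A with
  | PVar n => TVar n
  | PImp A B => Arr (star A) (star B)
  | PCon c A => All (rp_body (matrix (fun i => star (A i))))
  end.

(* Lambda X. lambda <x_k>_k. x_{k0} <t_j>_j, for [t_j] in the ambient context. *)
Definition rp_intro (M : seq (seq ty)) (k0 : nat) (ts : seq tm) : tm :=
  TLam (lams [seq arrs (map (tshift 1) As) (TVar 0) | As <- M]
    (apps (bvar (size M) k0) [seq weaken 0 (size M) 1 t | t <- ts])).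

Fixpoint star_tm (u : pterm) : tm :=
  match u with
  | PV n => Var n
  | PLam A t => Lam (star A) (star_tm t)
  | PApp t u => App (star_tm t) (star_tm u)
  | PIota c k A t =>
      rp_intro (matrix (fun i => star (A i))) k
        [seq star_tm (t j) | j : fiber c k]
  | PDelta c A C t s =>
      apps (TApp (star_tm t) (rp_body (matrix (fun i => star (A i)))) (star C))
        [seq lams (row (fun i => star (A i)) k) (star_tm (s k)) | k : 'I_(nK c)]
  end.

(** * The contexts El_B and In_B *)

(* Numbers of term and type variables bound by In_B. *)
Fixpoint nterm (B : ty) : nat :=
  match B with
  | TVar _ => 0
  | Arr _ D => (nterm D).+1
  | All D => nterm D
  end.

Fixpoint ntype (B : ty) : nat :=
  match B with
  | TVar _ => 0
  | Arr _ D => ntype D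
  | All D => (ntype D).+1
  end.

(* The rightmost variable of B, as an index in the scope of the type variables
   bound by In_B; this covers both the free and the bound case. *)
Fixpoint atvar (B : ty) : nat :=
  match B with
  | TVar n => n
  | Arr _ D => atvar D
  | All D => atvar D
  end.

(* Capturing substitution In_B{u}: [u] lives in the scope of the variables bound
   by In_B. *)
Fixpoint In_cap (B : ty) (u : tm) : tm :=
  match B with
  | TVar _ => u
  | Arr C D => Lam C (In_cap D u)
  | All D => TLam (In_cap D u)
  end.

(* El_B[v], in the scope of the variables bound by In_B followed by [m] further
   term variables: the variables x and X introduced by El_B are those bound by
   In_B.  The type [B] is given as seen outside In_B, and [v] has type
   [tshift (ntype B) B]; the annotation of the type application is shifted
   accordingly. *)
Fixpoint El_hole (m : nat) (B : ty) (v : tm) : tm :=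
  match B with
  | TVar _ => v
  | Arr C D => El_hole m D (App v (Var (m + nterm D)))
  | All D =>
      El_hole m D
        (TApp v (tren (upr (addn (ntype D).+1)) D) (TVar (ntype D)))
  end.

(* In_B{t Z <lambda <w_j>_j. El_B[v_k]>_k} with Z = at(B), for
   [t : All (rp_body M)] and [vs = <v_k>_k], where [t] lives in the ambient
   context and [v_k] in its extension by <w_j>_j. *)
Definition rp_elim (t : tm) (M : seq (seq ty)) (B : ty) (vs : seq tm) : tm :=
  let M' := map (map (tshift (ntype B))) M in
  In_cap B
    (apps (TApp (weaken 0 (nterm B) (ntype B) t) (rp_body M') (TVar (atvar B)))
      (mkseq (fun k =>
        let As := nth [::] M' k in
        let m := size As in
        lams As (El_hole m B
          (weaken m (nterm B) (ntype B) (nth (Var 0) vs k)))) (size M))).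

(** * The two atomizations *)

(* Both are total functions on terms of System F, but are meant for those of
   NI^2_RP, where the annotation of a type application is [rp_body M]. *)

(* [ff_inst t M B] is the FF-atomization of the application to [B] of a term of
   type [All (rp_body M)] whose FF-atomization is [t]. *)
Fixpoint ff_inst (t : tm) (M : seq (seq ty)) (B : ty) : tm :=
  let n := size M in
  match B with
  | TVar Y => TApp t (rp_body M) (TVar Y)
  | Arr C D =>
      lams [seq arrs As (Arr C D) | As <- M]
        (Lam C
          (apps (ff_inst (weaken 0 n.+1 0 t) M D)
            (mkseq (fun k =>
              let As := nth [::] M k in
              let m := size As in
              lams As
                (App (apps (weaken 0 m.+1 0 (bvar n k)) (bvars m)) (Var m))) n)))
  | All D =>
      let M' := map (map (tshift 1)) M in
      lams [seq arrs As (All D) | As <- M]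
        (TLam
          (apps (ff_inst (weaken 0 n 1 t) M' D)
            (mkseq (fun k =>
              let As := nth [::] M' k in
              let m := size As in
              lams As
                (TApp (apps (weaken 0 m 0 (bvar n k)) (bvars m))
                  (tren (upr succn) D) (TVar 0))) n)))
  end.

Fixpoint ff (t : tm) : tm :=
  match t with
  | Var n => Var n
  | Lam A t => Lam A (ff t)
  | App t u => App (ff t) (ff u)
  | TLam t => TLam (ff t)
  | TApp t T B => ff_inst (ff t) (rp_matrix T) B
  end.

Definition eps_inst (t : tm) (M : seq (seq ty)) (B : ty) : tm :=
  let n := size M in
  if B is TVar Y then TApp t (rp_body M) (TVar Y) else
  lams [seq arrs As B | As <- M]
    (rp_elim (weaken 0 n 0 t) M B
      (mkseq (fun k =>
        let m := size (nth [::] M k) in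
        apps (weaken 0 m 0 (bvar n k)) (bvars m)) n)).

Fixpoint eps (t : tm) : tm :=
  match t with
  | Var n => Var n
  | Lam A t => Lam A (eps t)
  | App t u => App (eps t) (eps u)
  | TLam t => TLam (eps t)
  | TApp t T B => eps_inst (eps t) (rp_matrix T) B
  end.

(** * The ESF-translation *)

Fixpoint sharp (u : pterm) : tm :=
  match u with
  | PV n => Var n
  | PLam A t => Lam (star A) (sharp t)
  | PApp t u => App (sharp t) (sharp u)
  | PIota c k A t =>
      rp_intro (matrix (fun i => star (A i))) k
        [seq sharp (t j) | j : fiber c k]
  | PDelta c A C t s =>
      rp_elim (sharp t) (matrix (fun i => star (A i))) (star C)
        [seq sharp (s k) | k : 'I_(nK c)]
  end.

(* Main.v *)
Require Import Defs.
From mathcomp Require Import all_boot.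

Set Implicit Arguments.
Unset Strict Implicit.
Unset Printing Implicit Defensive.

(** Write n for the number of rows of a matrix M = <A_k>_k of types, and let
    [t : All (rp_body M)].

    Everything rests on one computation, [red_eps_inst_apps]: if the
    epsilon-atomization of the application of [t] to [B] is applied to the n
    branches <lambda <w_j>. v_k>_k, it reduces to
    In_B{t Z <lambda <w_j>. El_B[v_k]>_k}, which is [rp_elim t M B v].  Indeed the
    outer abstractions over the y_k are consumed by a multiple beta-step
    ([red_lams_apps]), which turns El_B[y_k <w_j>] into
    El_B[(lambda <w_j>. v_k) <w_j>], and the remaining redexes are contracted
    inside El_B ([red_lams_bvars], [red_rp_elim]).

    For (1), the FF-atomization of a single application reduces to its
    epsilon-atomization ([red_ff_inst]), by induction on the type argument [B].
    For [B = C -> D], the FF-atomization is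
    lambda <y_k>. lambda x. (t D) <lambda <z_j>. y_k <z_j> x>_k; by induction
    (t D) becomes the epsilon-atomization at [D], and the computation above, for
    the branches v_k = y_k <z_j> x, produces
    In_D{t Z <lambda <z_j>. El_D[y_k <z_j> x]>_k}.  As El_B = El_D[[ ] x] and
    In_B = lambda x. In_D, this is literally the epsilon-atomization at [B].
    Quantified types are similar.

    For (2), the epsilon-atomization of the translation of an elimination is
    exactly of the form treated by the computation, which yields the
    ESF-translation.  The remaining cases of the induction on the derivation
    ([red_translations]) are congruences.

    The de Bruijn representation calls for one commutation fact beyond the usual
    substitution calculus: [rp_elim] commutes with renaming of types and
    substitution of terms ([inst_rp_elim]). *)

(** * Renaming types *)

Lemma upr_ext r r' : r =1 r' -> upr r =1 upr r'.
Proof. by move=> e [|n] //=; rewrite e. Qed.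

Lemma tren_ext r r' A : r =1 r' -> tren r A = tren r' A.
Proof.
elim: A r r' => [n|A IHA B IHB|A IHA] r r' e /=; first by rewrite e.
  by rewrite (IHA _ _ e) (IHB _ _ e).
by rewrite (IHA _ _ (upr_ext e)).
Qed.

Lemma upr_comp r r' n : upr r' (upr r n) = upr (r' \o r) n.
Proof. by case: n. Qed.

Lemma tren_comp r r' A : tren r' (tren r A) = tren (r' \o r) A.
Proof.
elim: A r r' => [n|A IHA B IHB|A IHA] r r' //=; first by rewrite IHA IHB.
by rewrite IHA; congr All; apply: tren_ext => n; apply: upr_comp.
Qed.

Lemma upr_id : upr id =1 id.
Proof. by case. Qed.

Lemma tren_id A : tren id A = A.
Proof.
by elim: A => [n|A IHA B IHB|A IHA] //=; rewrite ?IHA ?IHB ?(tren_ext _ upr_id) ?IHA.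
Qed.

Lemma tren_tinst r Y A : tren r (tinst Y A) = tinst (r Y) (tren (upr r) A).
Proof. by rewrite /tinst !tren_comp; apply: tren_ext => -[]. Qed.

Lemma tshift_upr r A : tshift 1 (tren r A) = tren (upr r) (tshift 1 A).
Proof. by rewrite /tshift !tren_comp; apply: tren_ext. Qed.

Lemma map_tshift_upr r As :
  map (tren (upr r)) (map (tshift 1) As) = map (tshift 1) (map (tren r) As).
Proof. by rewrite -!map_comp; apply: eq_map => A /=; rewrite tshift_upr. Qed.

Lemma tren_arrs r As B : tren r (arrs As B) = arrs (map (tren r) As) (tren r B).
Proof. by elim: As => //= A As ->. Qed.

Lemma tren_rp_body r M :
  tren (upr r) (rp_body M) = rp_body (map (map (tren r)) M).
Proof.
rewrite /rp_body tren_arrs -!map_comp; congr arrs.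
by apply: eq_map => As /=; rewrite tren_arrs map_tshift_upr.
Qed.

Lemma tinst_rp_body Y M :
  tinst Y (rp_body M) = arrs [seq arrs As (TVar Y) | As <- M] (TVar Y).
Proof.
rewrite /tinst /rp_body tren_arrs -map_comp; congr arrs.
apply: eq_map => As /=; rewrite tren_arrs -map_comp; congr arrs.
by rewrite -[RHS]map_id; apply: eq_map => A; rewrite /= tren_comp tren_id.
Qed.

(** * Simultaneous renaming of types and substitution of terms *)

(** The substitution [s] carried under a term binder. *)
Definition up (s : nat -> tm) : nat -> tm :=
  scons (Var 0) (fun n => ren succn (s n)).

(** The substitution [s] carried under a type binder. *)
Definition tup (s : nat -> tm) (n : nat) : tm := rent succn (s n).

(** [inst r s t] renames the type variables of [t] along [r] and substitutes
    the terms [s n] for its term variables.  Weakening, substitution and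
    instantiation of type variables by type variables are all instances, so
    that the single composition law [inst_comp] covers their interaction. *)
Fixpoint inst (r : nat -> nat) (s : nat -> tm) (t : tm) : tm :=
  match t with
  | Var n => s n
  | Lam A t => Lam (tren r A) (inst r (up s) t)
  | App t u => App (inst r s t) (inst r s u)
  | TLam t => TLam (inst (upr r) (tup s) t)
  | TApp t T B => TApp (inst r s t) (tren (upr r) T) (tren r B)
  end.

Lemma inst_ext r r' s s' t : r =1 r' -> s =1 s' -> inst r s t = inst r' s' t.
Proof.
elim: t r r' s s' => [n|A t IH|t IHt u IHu|t IH|t IH T B] r r' s s' er es /=.
- exact: es.
- rewrite (tren_ext _ er); congr Lam; apply: IH => // -[|n] //=.
  by rewrite es.
- by rewrite (IHt _ _ _ _ er es) (IHu _ _ _ _ er es).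
- congr TLam; apply: IH; first exact: upr_ext.
  by move=> n; rewrite /tup es.
- by rewrite (IH _ _ _ _ er es) (tren_ext _ er) (tren_ext _ (upr_ext er)).
Qed.

Lemma renE r t : ren r t = inst id (fun n => Var (r n)) t.
Proof.
elim: t r => [n|A t IH|t IHt u IHu|t IH|t IH T B] r //=.
- rewrite tren_id IH; congr Lam; apply: inst_ext => // -[|n] //.
- by rewrite IHt IHu.
- rewrite IH; congr TLam; apply: inst_ext => // n; by rewrite upr_id.
- by rewrite IH tren_id (tren_ext _ upr_id) tren_id.
Qed.

Lemma rentE r t : rent r t = inst r (fun n => Var (id n)) t.
Proof.
elim: t r => [n|A t IH|t IHt u IHu|t IH|t IH T B] r //=; rewrite ?IH ?IHt ?IHu //.
by congr Lam; apply: inst_ext => // -[].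
Qed.

Lemma substE s t : subst s t = inst id s t.
Proof.
elim: t s => [n|A t IH|t IHt u IHu|t IH|t IH T B] s //=.
- by rewrite tren_id IH.
- by rewrite IHt IHu.
- rewrite IH; congr TLam; apply: inst_ext => // n; by rewrite upr_id.
- by rewrite IH tren_id (tren_ext _ upr_id) tren_id.
Qed.

Lemma inst_id t : inst id Var t = t.
Proof.
rewrite -rentE; elim: t => [n|A t IH|t IHt u IHu|t IH|t IH T B] //=;
  rewrite ?tren_id ?IH ?IHt ?IHu //.
- by rewrite rentE (inst_ext _ upr_id (frefl _)) -rentE IH.
- by rewrite (tren_ext _ upr_id) tren_id.
Qed.

(** [inst_instV] and [instV_inst] are the cases of [inst_comp] in which one of
    the two substitutions is a renaming; they are needed to push the general
    case under binders. *)
Lemma inst_instV r r' s' p t :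
  inst r' s' (inst r (fun n => Var (p n)) t) = inst (r' \o r) (s' \o p) t.
Proof.
elim: t r r' s' p => [n|A t IH|t IHt u IHu|t IH|t IH T B] r r' s' p //=.
- rewrite tren_comp; congr Lam.
  rewrite (@inst_ext r r (up _) (fun n => Var (upr p n))) //; last by case.
  by rewrite IH; apply: inst_ext => // -[].
- by rewrite IHt IHu.
- rewrite IH; congr TLam; apply: inst_ext => // n; exact: upr_comp.
- rewrite IH !tren_comp; congr TApp; apply: tren_ext => n; exact: upr_comp.
Qed.

Lemma instV_inst r r' s p t :
  inst r' (fun n => Var (p n)) (inst r s t) =
  inst (r' \o r) (fun n => inst r' (fun n => Var (p n)) (s n)) t.
Proof.
elim: t r r' s p => [n|A t IH|t IHt u IHu|t IH|t IH T B] r r' s p //=.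
- rewrite tren_comp; congr Lam.
  rewrite (@inst_ext r' r' (up _) (fun n => Var (upr p n))) //; last by case.
  rewrite IH; apply: inst_ext => // -[|n] //=.
  by rewrite !renE !inst_instV.
- by rewrite IHt IHu.
- rewrite (@inst_ext (upr r') (upr r') (tup _) (fun n => Var (p n))) // IH; congr TLam.
  apply: inst_ext => n; first exact: upr_comp.
  by rewrite /tup !rentE !inst_instV.
- rewrite IH !tren_comp; congr TApp; apply: tren_ext => n; exact: upr_comp.
Qed.

Lemma inst_comp r r' s s' t :
  inst r' s' (inst r s t) = inst (r' \o r) (fun n => inst r' s' (s n)) t.
Proof.
elim: t r r' s s' => [n|A t IH|t IHt u IHu|t IH|t IH T B] r r' s s' //=.
- rewrite tren_comp IH; congr Lam; apply: inst_ext => // -[|n] //=.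
  by rewrite !renE inst_instV instV_inst; apply: inst_ext => m //=; rewrite renE.
- by rewrite IHt IHu.
- rewrite IH; congr TLam; apply: inst_ext => n; first exact: upr_comp.
  rewrite /tup !rentE inst_instV instV_inst.
  by apply: inst_ext => m //=; rewrite /tup rentE.
- rewrite IH !tren_comp; congr TApp; apply: tren_ext => n; exact: upr_comp.
Qed.

Lemma weakenE m d e t :
  weaken m d e t =
  inst (addn e) (fun i => Var (if i < m then i else d + i)) t.
Proof. by rewrite /weaken renE rentE inst_instV. Qed.

Lemma inst_subst1 r s u t :
  inst r s (subst1 u t) = subst1 (inst r s u) (inst r (up s) t).
Proof.
rewrite /subst1 !substE !inst_comp; apply: inst_ext => // -[|n] //=.
by rewrite renE inst_instV inst_id.
Qed.

Lemma inst_tinst_tm r s Y t :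
  inst r s (tinst_tm Y t) = tinst_tm (r Y) (inst (upr r) (tup s) t).
Proof.
rewrite /tinst_tm !rentE !inst_comp; apply: inst_ext => [[|n]|n] //=.
by rewrite /tup rentE inst_instV inst_id.
Qed.

(** * Typing and subject reduction *)

(** [inst r s] maps terms in the context [G] to terms in the context [G']. *)
Definition inst_typing (r : nat -> nat) (s : nat -> tm) (G G' : seq ty) : Prop :=
  forall n A, onth G n = Some A -> typing G' (s n) (tren r A).

Lemma onth_map_Some (T U : Type) (f : T -> U) s n y :
  onth (map f s) n = Some y -> exists2 x, onth s n = Some x & y = f x.
Proof. by rewrite onth_map; case: (onth s n) => //= x [<-]; exists x. Qed.

Lemma typing_instV r p t G G' A :
  (forall n A, onth G n = Some A -> onth G' (p n) = Some (tren r A)) ->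
  typing G t A -> typing G' (inst r (fun n => Var (p n)) t) (tren r A).
Proof.
move=> h ht; elim: ht r p G' h => {G t A} /=.
- by move=> G n A e r p G' h; apply: t_var; apply: h.
- move=> G A B t _ IH r p G' h; apply: t_lam.
  rewrite (@inst_ext r r (up _) (fun n => Var (upr p n))) //; last by case.
  by apply: IH => -[|n] C /= => [[->]|] //; apply: h.
- move=> G A B t u _ IHt _ IHu r p G' h.
  by apply: t_app; [exact: IHt | exact: IHu].
- move=> G A t _ IH r p G' h; apply: t_tlam.
  apply: (IH (upr r) p) => n C eC; have [D e ->] := onth_map_Some eC.
  by rewrite onth_map (h _ _ e) /= tshift_upr.
- by move=> G A t Y _ IH r p G' h; rewrite tren_tinst; apply: t_tapp; exact: IH.
Qed.

Lemma inst_typing_up r s A G G' :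
  inst_typing r s G G' -> inst_typing r (up s) (A :: G) (tren r A :: G').
Proof.
move=> h [|n] C /= => [[<-]|/h {}h]; first exact: t_var.
by rewrite renE -[tren r C]tren_id; apply: typing_instV h => m D; rewrite tren_id.
Qed.

Lemma inst_typing_tup r s G G' :
  inst_typing r s G G' ->
  inst_typing (upr r) (tup s) (map (tshift 1) G) (map (tshift 1) G').
Proof.
move=> h n C eC; have [D /h{}h ->] := onth_map_Some eC.
rewrite -tshift_upr /tup rentE; apply: typing_instV h => m E /= e.
by rewrite onth_map e.
Qed.

Lemma typing_inst r s t G G' A :
  inst_typing r s G G' -> typing G t A -> typing G' (inst r s t) (tren r A).
Proof.
move=> h ht; elim: ht r s G' h => {G t A} /=.
- by move=> G n A e r s G' h; apply: h.
- by move=> G A B t _ IH r s G' h; apply: t_lam; apply: IH; apply: inst_typing_up.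
- move=> G A B t u _ IHt _ IHu r s G' h.
  by apply: t_app; [exact: IHt | exact: IHu].
- by move=> G A t _ IH r s G' h; apply: t_tlam; apply: IH; apply: inst_typing_tup.
- by move=> G A t Y _ IH r s G' h; rewrite tren_tinst; apply: t_tapp; exact: IH.
Qed.

(** Includes subject reduction. *)
Lemma red_typing G t u A : red G t u A -> typing G t A /\ typing G u A.
Proof.
elim=> {G t u A}.
- by [].
- by move=> G t u v A _ [? _] _ [].
- by move=> G A B t t' _ [? ?]; split; apply: t_lam.
- by move=> G A B t t' u u' _ [? ?] _ [? ?]; split; apply: t_app; eassumption.
- by move=> G A t t' _ [? ?]; split; apply: t_tlam.
- by move=> G A t t' Y _ [? ?]; split; apply: t_tapp.
- move=> G A B t u ht hu; split; first exact: t_app (t_lam ht) hu.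
  rewrite /subst1 substE -[B]tren_id; apply: typing_inst ht => -[|n] C /=.
    by case=> <-; rewrite tren_id.
  by rewrite tren_id; apply: t_var.
- move=> G A t Y ht; split; first exact: t_tapp (t_tlam ht).
  rewrite /tinst_tm rentE; apply: typing_inst ht => n C eC; have [D e ->] := onth_map_Some eC.
  by rewrite tren_comp tren_id; apply: t_var.
Qed.

Lemma red_inst r s t u G G' A :
  inst_typing r s G G' -> red G t u A -> red G' (inst r s t) (inst r s u) (tren r A).
Proof.
move=> h ht; elim: ht r s G' h => {G t u A} /=.
- by move=> G t A ht r s G' h; apply: r_refl; apply: typing_inst ht.
- move=> G t u v A _ IHt _ IHu r s G' h.
  by apply: r_trans (IHt _ _ _ h) (IHu _ _ _ h).
- by move=> G A B t t' _ IH r s G' h; apply: r_lam; apply: IH; apply: inst_typing_up.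
- move=> G A B t t' u u' _ IHt _ IHu r s G' h.
  by apply: r_app; [exact: IHt | exact: IHu].
- by move=> G A t t' _ IH r s G' h; apply: r_tlam; apply: IH; apply: inst_typing_tup.
- by move=> G A t t' Y _ IH r s G' h; rewrite tren_tinst; apply: r_tapp; exact: IH.
- move=> G A B t u ht hu r s G' h; rewrite inst_subst1; apply: r_beta.
    by apply: typing_inst ht; apply: inst_typing_up.
  exact: typing_inst hu.
- move=> G A t Y ht r s G' h; rewrite tren_tinst inst_tinst_tm; apply: r_tbeta.
  by apply: typing_inst ht; apply: inst_typing_tup.
Qed.

(** * Iterated abstractions and applications *)

(** The substitution [s] carried under [m] term binders. *)
Definition ups (m : nat) : (nat -> tm) -> nat -> tm := iter m up.

Lemma ups_lt m s i : i < m -> ups m s i = Var i.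
Proof. by elim: m i => // m IH [|i] //= lti; rewrite IH. Qed.

Lemma ups_add m s i : ups m s (m + i) = ren (addn m) (s i).
Proof.
elim: m => [|m IH]; first by rewrite renE inst_id.
by rewrite addSn /= -/(ups m s) IH !renE inst_instV.
Qed.

Lemma inst_lams r s As t :
  inst r s (lams As t) = lams (map (tren r) As) (inst r (ups (size As) s) t).
Proof. by elim: As s => //= A As IH s; rewrite IH /ups -iterSr. Qed.

Lemma inst_apps r s t us :
  inst r s (apps t us) = apps (inst r s t) (map (inst r s) us).
Proof. by elim: us t => //= u us IH t; rewrite IH. Qed.

Lemma nth_bvars m i : i < m -> nth (Var 0) (bvars m) i = bvar m i.
Proof. exact: nth_mkseq. Qed.

Lemma inst_bvars_ups r s m : map (inst r (ups m s)) (bvars m) = bvars m.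
Proof.
rewrite /bvars /mkseq -map_comp; apply/eq_in_map => i.
by rewrite mem_iota add0n => /= lti; rewrite ups_lt // ltn_subrL; case: m lti.
Qed.

Lemma red_lams G As t t' B :
  red (rev As ++ G) t t' B -> red G (lams As t) (lams As t') (arrs As B).
Proof.
elim: As G => //= A As IH G h; apply: r_lam; apply: IH.
by rewrite rev_cons cat_rcons in h.
Qed.

Lemma typing_lams G As t B :
  typing (rev As ++ G) t B -> typing G (lams As t) (arrs As B).
Proof. by move=> /r_refl/red_lams/red_typing[]. Qed.

(** Componentwise reduction of lists of terms. *)
Inductive reds (G : seq ty) : seq tm -> seq tm -> seq ty -> Prop :=
| reds_nil : reds G [::] [::] [::]
| reds_cons u u' us us' A As :
    red G u u' A -> reds G us us' As -> reds G (u :: us) (u' :: us') (A :: As).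

Lemma reds_map (I : eqType) G (f f' : I -> tm) (F : I -> ty) (s : seq I) :
  (forall i, i \in s -> red G (f i) (f' i) (F i)) ->
  reds G (map f s) (map f' s) (map F s).
Proof.
elim: s => [|i s IH] h /=; first exact: reds_nil.
apply: reds_cons; first by apply: h; rewrite inE eqxx.
by apply: IH => j js; apply: h; rewrite inE js orbT.
Qed.

Lemma reds_mkseq G (f f' : nat -> tm) (T : Type) (F : T -> ty) x0 (M : seq T) :
  (forall k, k < size M -> red G (f k) (f' k) (F (nth x0 M k))) ->
  reds G (mkseq f (size M)) (mkseq f' (size M)) (map F M).
Proof.
move=> h; rewrite -[in map F M](mkseq_nth x0 M) /mkseq -map_comp.
by apply: reds_map => k; rewrite mem_iota; apply: h.
Qed.

Lemma reds_left G us us' As : reds G us us' As -> reds G us us As.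
Proof.
elim=> [|u u' vs vs' A Bs /red_typing[h _] _ IH]; first exact: reds_nil.
by apply: reds_cons => //; apply: r_refl.
Qed.

Lemma red_apps G As t t' us us' B :
  red G t t' (arrs As B) -> reds G us us' As -> red G (apps t us) (apps t' us') B.
Proof.
move=> ht h; elim: h t t' ht => //= u u' vs vs' A Bs hu _ IH t t' ht.
by apply: IH; apply: r_app hu.
Qed.

Lemma onth_bvar (T : Type) (G As : seq T) i x0 :
  i < size As -> onth (rev As ++ G) (size As - i.+1) = Some (nth x0 As i).
Proof.
move=> lti; have ltj : size As - i.+1 < size (rev As).
  by rewrite size_rev ltn_subrL (leq_ltn_trans _ lti).
rewrite onth_cat ltj onthE (nth_map x0) // nth_rev.
  by rewrite subnSK // subKn // ltnW.
by rewrite size_rev in ltj.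
Qed.

Lemma reds_bvars G As :
  reds (rev As ++ G) (bvars (size As)) (bvars (size As)) As.
Proof.
rewrite -[X in reds _ _ _ X]map_id; apply: (reds_mkseq (x0 := TVar 0)) => i lti.
by apply: r_refl; apply: t_var; apply: onth_bvar.
Qed.

(** The simultaneous substitution effected by a multiple beta-step: the last
    term of [us] replaces the variable of index 0. *)
Definition msub (us : seq tm) (i : nat) : tm :=
  if i < size us then nth (Var 0) us (size us - i.+1) else Var (i - size us).

Lemma size_reds G us us' As : reds G us us' As -> size us = size As.
Proof. by elim=> //= u u' vs vs' A Bs _ _ ->. Qed.

Lemma msub_lt us i : i < size us -> msub us i = nth (Var 0) us (size us - i.+1).
Proof. by rewrite /msub => ->. Qed.

Lemma msub_add us i : msub us (size us + i) = Var i.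
Proof. by rewrite /msub ltnNge leq_addr addKn. Qed.

Lemma inst_typing_ups r s As G G' :
  inst_typing r s G G' ->
  inst_typing r (ups (size As) s) (rev As ++ G) (rev (map (tren r) As) ++ G').
Proof.
elim/last_ind: As => [|As A IH] //= /IH h.
rewrite size_rcons map_rcons !rev_rcons; exact: inst_typing_up.
Qed.

(** One beta-step for the first argument, followed by the multiple beta-step for
    the other ones. *)
Lemma inst_msub us u t :
  inst id (msub us) (inst id (ups (size us) (scons u Var)) t) =
  inst id (msub (u :: us)) t.
Proof.
rewrite inst_comp; apply: inst_ext => // i.
have [lti|] := ltnP i (size us).
  by rewrite ups_lt //= !msub_lt /= ?(leqW lti) // subSS -(subnSK lti).
move=> /subnKC <-; case: (i - _) => [|j].
  rewrite ups_add /= renE inst_instV addn0 msub_lt //= subnn /=.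
  rewrite -[RHS]inst_id; apply: inst_ext => // j; exact: msub_add.
by rewrite ups_add /= addnS -addSn !msub_add.
Qed.

Lemma red_lams_apps G As t us us' B :
  typing (rev As ++ G) t B -> reds G us us' As ->
  red G (apps (lams As t) us) (inst id (msub us) t) B.
Proof.
move=> ht h; elim: h t ht => {us us' As} [|u u' us us' A As hu hus IH] t /=.
  move=> ht; rewrite (inst_ext t (frefl id) (s' := Var)) ?inst_id.
    exact: r_refl.
  by move=> i; rewrite -[i in LHS]add0n (msub_add [::]).
rewrite rev_cons cat_rcons => ht; have [tu _] := red_typing hu.
have sz := size_reds hus.
have tt : typing (rev As ++ G) (inst id (ups (size us) (scons u Var)) t) B.
  rewrite -[B]tren_id sz -[in rev As](map_id As) -(eq_map tren_id).
  apply: typing_inst ht; apply: inst_typing_ups => -[|n] C /=.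
    by case=> <-; rewrite tren_id.
  by rewrite tren_id; apply: t_var.
apply: (@r_trans _ _ (apps (subst1 u (lams As t)) us)).
  by apply: red_apps (reds_left hus); apply: r_beta => //; apply: typing_lams.
rewrite /subst1 substE inst_lams (eq_map tren_id) map_id -inst_msub -sz.
exact: IH.
Qed.

(** * Weakening *)

Lemma tshift0 A : tshift 0 A = A.
Proof. by rewrite -[RHS]tren_id; apply: tren_ext. Qed.

Lemma tshiftD d e A : tshift d (tshift e A) = tshift (d + e) A.
Proof. by rewrite /tshift tren_comp; apply: tren_ext => n /=; rewrite addnA. Qed.

Lemma map_tshiftD d e As :
  map (tshift d) (map (tshift e) As) = map (tshift (d + e)) As.
Proof. by rewrite -map_comp; apply: eq_map => A /=; rewrite tshiftD. Qed.

Lemma onth_cat_add (T : Type) (s1 s2 : seq T) i :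
  onth (s1 ++ s2) (size s1 + i) = onth s2 i.
Proof. by rewrite onth_cat ltnNge leq_addr addKn. Qed.

Lemma red_weaken G G' m d e t u A :
  (forall i A, onth G i = Some A ->
    onth G' (if i < m then i else d + i) = Some (tshift e A)) ->
  red G t u A -> red G' (weaken m d e t) (weaken m d e u) (tshift e A).
Proof.
by move=> h ht; rewrite !weakenE; apply: red_inst ht => i C /h; apply: t_var.
Qed.

Lemma red_weaken_cat G Ps t u A :
  red G t u A ->
  red (rev Ps ++ G) (weaken 0 (size Ps) 0 t) (weaken 0 (size Ps) 0 u) A.
Proof.
rewrite -[in X in _ -> X](tshift0 A); apply: red_weaken => i C e.
by rewrite tshift0 -(size_rev Ps) onth_cat_add.
Qed.

Lemma red_weaken_shift_cat G Ps t u A :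
  red G t u A ->
  red (rev Ps ++ map (tshift 1) G)
    (weaken 0 (size Ps) 1 t) (weaken 0 (size Ps) 1 u) (tshift 1 A).
Proof.
apply: red_weaken => i C e.
by rewrite -(size_rev Ps) onth_cat_add onth_map e.
Qed.

Lemma weaken_weaken m d e d' e' t :
  weaken m d e (weaken m d' e' t) = weaken m (d + d') (e + e') t.
Proof.
rewrite !weakenE inst_instV; apply: inst_ext => i /=; first by rewrite addnA.
case: (ltnP i m) => [-> //|lei].
by rewrite ltnNge (leq_trans lei) ?leq_addl //= addnA.
Qed.

Lemma weaken0 m t : weaken m 0 0 t = t.
Proof.
by rewrite weakenE -[RHS]inst_id; apply: inst_ext => // i; rewrite if_same.
Qed.

Lemma weaken_apps m d e t us :
  weaken m d e (apps t us) = apps (weaken m d e t) (map (weaken m d e) us).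
Proof.
by rewrite weakenE inst_apps -weakenE; congr apps; apply: eq_map => u; rewrite weakenE.
Qed.

Lemma weaken_bvars m d e : map (weaken m d e) (bvars m) = bvars m.
Proof.
rewrite -[RHS](inst_bvars_ups (addn e) (fun i => Var (d + i)) m).
apply: eq_map => t; rewrite weakenE; apply: inst_ext => // i.
have [lti|lei] := ltnP i m; first by rewrite ups_lt.
by rewrite -(subnKC lei) ups_add /= addnCA.
Qed.

(** * The contexts El_B and In_B *)

(** The context [G] extended by the variables that In_B binds. *)
Fixpoint In_ctx (B : ty) (G : seq ty) : seq ty :=
  match B with
  | TVar _ => G
  | Arr C D => In_ctx D (C :: G)
  | All D => In_ctx D (map (tshift 1) G)
  end.

Lemma onth_In_ctx B G n A :
  onth G n = Some A ->
  onth (In_ctx B G) (nterm B + n) = Some (tshift (ntype B) A).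
Proof.
elim: B G n A => [m|C _ D IH|D IH] G n A e.
- by rewrite tshift0.
- by rewrite [nterm _]/= addSn -addnS; apply: IH.
by rewrite [ntype _]/= -addn1 -tshiftD; apply: IH; rewrite onth_map e.
Qed.

Lemma red_In_cap B G u u' :
  red (In_ctx B G) u u' (TVar (atvar B)) -> red G (In_cap B u) (In_cap B u') B.
Proof.
elim: B G => //= [C _ D IH|D IH] G h; first by apply: r_lam; apply: IH.
by apply: r_tlam; apply: IH.
Qed.

Lemma red_El_hole B G W v v' :
  red (W ++ In_ctx B G) v v' (tshift (ntype B) B) ->
  red (W ++ In_ctx B G) (El_hole (size W) B v) (El_hole (size W) B v')
    (TVar (atvar B)).
Proof.
elim: B G v v' => //= [C _ D IH|D IH] G v v' h.
  apply: IH; apply: r_app h _; apply: r_refl; apply: t_var.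
  by rewrite onth_cat_add -[nterm D]addn0; apply: onth_In_ctx.
apply: IH.
have -> : tshift (ntype D) D =
          tinst (ntype D) (tren (upr (addn (ntype D).+1)) D).
  rewrite /tinst tren_comp; apply: tren_ext => -[|n] /=; first exact: addn0.
  by rewrite addnS.
exact: r_tapp.
Qed.

Lemma red_weaken_In_ctx B G W v v' A :
  red (W ++ G) v v' A ->
  red (map (tshift (ntype B)) W ++ In_ctx B G)
    (weaken (size W) (nterm B) (ntype B) v)
    (weaken (size W) (nterm B) (ntype B) v') (tshift (ntype B) A).
Proof.
apply: red_weaken => i C; rewrite !onth_cat size_map.
case: ltnP => [lti e|lei e]; first by rewrite lti onth_map e.
by rewrite ltnNge (leq_trans lei) ?leq_addl // -addnBA //; apply: onth_In_ctx.
Qed.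

Lemma red_rp_elim G t t' M B vs vs' :
  red G t t' (All (rp_body M)) ->
  (forall k, k < size M ->
    red (rev (nth [::] M k) ++ G) (nth (Var 0) vs k) (nth (Var 0) vs' k) B) ->
  red G (rp_elim t M B vs) (rp_elim t' M B vs') B.
Proof.
move=> ht hv; apply: red_In_cap.
set M' := map (map (tshift (ntype B))) M.
apply: (@red_apps _ [seq arrs As (TVar (atvar B)) | As <- M']).
  rewrite -tinst_rp_body; apply: r_tapp.
  have := red_weaken_In_ctx B (W := [::]) ht.
  by rewrite /tshift /= tren_rp_body.
rewrite -[size M](size_map (map (tshift (ntype B)))).
apply: (reds_mkseq (x0 := [::])) => k ltk; rewrite size_map in ltk.
rewrite /M' (nth_map [::]) // size_map; set As := nth [::] M k.
apply: red_lams; rewrite -map_rev -[size As]size_rev.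
rewrite -(size_map (tshift (ntype B)) (rev As)).
apply: red_El_hole; rewrite size_map; apply: red_weaken_In_ctx; exact: hv.
Qed.

(** The renaming [r] carried under [m] type binders. *)
Definition uprs (m : nat) : (nat -> nat) -> nat -> nat := iter m upr.

Lemma uprs_lt m r i : i < m -> uprs m r i = i.
Proof. by elim: m i => // m IH [|i] //= lti; rewrite IH. Qed.

Lemma uprs_add m r i : uprs m r (m + i) = m + r i.
Proof. by elim: m => // m IH; rewrite addSn /= -/(uprs m r) IH. Qed.

Lemma tren_tshift_uprs e r A : tren (uprs e r) (tshift e A) = tshift e (tren r A).
Proof. by rewrite /tshift !tren_comp; apply: tren_ext => i /=; rewrite uprs_add. Qed.

(** The substitution [s] carried under the binders of In_B. *)
Fixpoint In_up (B : ty) (s : nat -> tm) : nat -> tm :=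
  match B with
  | TVar _ => s
  | Arr _ D => In_up D (up s)
  | All D => In_up D (tup s)
  end.

Lemma In_up_lt B s i : i < nterm B -> In_up B s i = Var i.
Proof.
suff h n : (forall j, j < n -> s j = Var j) ->
    forall j, j < nterm B + n -> In_up B s j = Var j.
  by move=> lti; apply: (h 0); rewrite ?addn0.
elim: B s n => [m|C _ D IH|D IH] s n h j; first exact: h.
  rewrite [nterm _]/= addSnnS; apply: IH => -[|l] //= ltl; by rewrite h.
by apply: IH => l ltl; rewrite /tup h.
Qed.

Lemma In_up_add B s i :
  In_up B s (nterm B + i) = weaken 0 (nterm B) (ntype B) (s i).
Proof.
elim: B s i => [m|C _ D IH|D IH] s i /=.
- by rewrite weakenE (inst_ext _ (r' := id) (s' := Var)) ?inst_id.
- by rewrite addSn -addnS IH /= renE !weakenE inst_instV; apply: inst_ext => // j;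
    rewrite /= addnS.
- rewrite IH /tup rentE !weakenE inst_instV; apply: inst_ext => // j.
  by rewrite /= addnS.
Qed.

Lemma nterm_tren r B : nterm (tren r B) = nterm B.
Proof. by elim: B r => //= C _ D IH r; rewrite IH. Qed.

Lemma ntype_tren r B : ntype (tren r B) = ntype B.
Proof. by elim: B r => //= D IH r; rewrite IH. Qed.

Lemma atvar_tren r B : atvar (tren r B) = uprs (ntype B) r (atvar B).
Proof. by elim: B r => //= D IH r; rewrite IH /uprs -iterSr. Qed.

Lemma inst_In_cap r s B u :
  inst r s (In_cap B u) =
  In_cap (tren r B) (inst (uprs (ntype B) r) (In_up B s) u).
Proof.
elim: B r s => //= [C _ D IH|D IH] r s; rewrite IH //.
by rewrite /uprs -iterSr.
Qed.

Lemma inst_El_hole r s m B v :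
  (forall i, i < nterm B -> s (m + i) = Var (m + i)) ->
  inst (uprs (ntype B) r) s (El_hole m B v) =
  El_hole m (tren r B) (inst (uprs (ntype B) r) s v).
Proof.
elim: B r v => [//|C _ D IH|D IH] r v hs.
  by rewrite /= IH => [|i lti] /=; rewrite ?nterm_tren hs // ltnW.
have e : uprs (ntype (All D)) r = uprs (ntype D) (upr r) by rewrite /uprs iterSr.
rewrite e /= IH //= ntype_tren -e uprs_lt // !tren_comp.
congr (El_hole _ _ (TApp _ _ _)); apply: tren_ext => n.
apply: etrans (upr_comp _ _ _) (etrans _ (esym (upr_comp _ _ _))).
apply: upr_ext => {}n.
exact: (uprs_add (ntype D).+1).
Qed.

Lemma inst_weaken_In r s B t :
  inst (uprs (ntype B) r) (In_up B s) (weaken 0 (nterm B) (ntype B) t) =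
  weaken 0 (nterm B) (ntype B) (inst r s t).
Proof.
rewrite !weakenE inst_instV instV_inst; apply: inst_ext => i /=.
  by rewrite uprs_add.
by rewrite In_up_add weakenE.
Qed.

Lemma inst_weaken_ups_In r s m B t :
  inst (uprs (ntype B) r) (ups m (In_up B s)) (weaken m (nterm B) (ntype B) t) =
  weaken m (nterm B) (ntype B) (inst r (ups m s) t).
Proof.
rewrite !weakenE inst_instV instV_inst; apply: inst_ext => i /=.
  by rewrite uprs_add.
have [lti|lei] := ltnP i m; first by rewrite !ups_lt //= lti.
rewrite -(subnKC lei) addnCA !ups_add In_up_add renE weakenE renE !inst_instV.
apply: inst_ext => // j /=.
by rewrite ltnNge leq_addr addnCA.
Qed.

Definition tren_matrix (r : nat -> nat) : seq (seq ty) -> seq (seq ty) :=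
  map (map (tren r)).

Lemma tren_matrix_shift e r M :
  tren_matrix (uprs e r) (map (map (tshift e)) M) =
  map (map (tshift e)) (tren_matrix r M).
Proof.
rewrite /tren_matrix -!map_comp; apply: eq_map => As /=; rewrite -!map_comp.
by apply: eq_map => A /=; rewrite tren_tshift_uprs.
Qed.

Lemma inst_rp_elim r s t M B vs vs' :
  (forall k, k < size M -> nth (Var 0) vs' k =
    inst r (ups (size (nth [::] M k)) s) (nth (Var 0) vs k)) ->
  inst r s (rp_elim t M B vs) =
  rp_elim (inst r s t) (tren_matrix r M) (tren r B) vs'.
Proof.
move=> hv; rewrite /rp_elim inst_In_cap inst_apps /= inst_weaken_In nterm_tren.
rewrite ntype_tren tren_rp_body -atvar_tren -/(tren_matrix _ _).
rewrite tren_matrix_shift; congr (In_cap _ (apps _ _)).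
rewrite size_map /mkseq -map_comp; apply/eq_in_map => k.
rewrite mem_iota add0n => /= ltk.
rewrite -tren_matrix_shift inst_lams !(nth_map [::]) ?size_map //.
rewrite (hv k ltk) -inst_weaken_ups_In inst_El_hole //.
move=> i lti; rewrite ups_add In_up_lt //.
Qed.

(** * The epsilon-atomization of a type application *)

(** [rp_elim_Arr] and [rp_elim_All] peel off one layer of In_B and El_B: the
    hole of El_B receives the variable bound by the outermost abstraction of
    In_B, whose index in the scope of the m variables w_j is m for a term
    variable and 0 for a type variable. *)
Lemma rp_elim_Arr t M C D vs vs' :
  (forall k, k < size M -> nth (Var 0) vs' k =
    let m := size (nth [::] M k) in
    App (weaken m 1 0 (nth (Var 0) vs k)) (Var m)) ->
  rp_elim t M (Arr C D) vs = Lam C (rp_elim (weaken 0 1 0 t) M D vs').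
Proof.
move=> hv; rewrite /rp_elim /= weaken_weaken addn0 addn1.
congr (Lam _ (In_cap _ (apps _ _))); apply/eq_in_map => k.
rewrite mem_iota add0n => /= ltk; rewrite hv //=; congr lams.
rewrite (nth_map [::]) // size_map.
rewrite weakenE [in RHS]weakenE /= -!weakenE weaken_weaken addn0 addn1.
by rewrite ltnn addnC.
Qed.

Lemma rp_elim_All t M D vs vs' :
  (forall k, k < size M -> nth (Var 0) vs' k =
    TApp (weaken (size (nth [::] M k)) 0 1 (nth (Var 0) vs k))
      (tren (upr succn) D) (TVar 0)) ->
  rp_elim t M (All D) vs =
  TLam (rp_elim (weaken 0 0 1 t) (map (map (tshift 1)) M) D vs').
Proof.
move=> hv; rewrite /rp_elim /= weaken_weaken addn0 addn1.
have -> : map (map (tshift (ntype D))) (map (map (tshift 1)) M) =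
          map (map (tshift (ntype D).+1)) M.
  rewrite -map_comp; apply: eq_map => As /=.
  by rewrite map_tshiftD addn1.
congr (TLam (In_cap _ (apps _ _))); rewrite size_map; apply/eq_in_map => k.
rewrite mem_iota add0n => /= ltk; rewrite hv //=; congr lams.
rewrite (nth_map [::]) // size_map.
rewrite weakenE [in RHS]weakenE /= -!weakenE weaken_weaken addn0 addn1.
congr (El_hole _ _ (TApp _ _ _)); last by rewrite addn0.
rewrite tren_comp; apply: tren_ext => n.
apply: etrans _ (esym (upr_comp _ _ _)); apply: upr_ext => {}n /=.
by rewrite addnS.
Qed.

(** The eta-long forms y_k <w_j>_j of the variables y_k of [eps_inst]. *)
Definition eps_args (M : seq (seq ty)) : seq tm :=
  mkseq (fun k =>
    let m := size (nth [::] M k) in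
    apps (weaken 0 m 0 (bvar (size M) k)) (bvars m)) (size M).

Lemma red_eps_body G t t' M B :
  red G t t' (All (rp_body M)) ->
  let Ps := [seq arrs As B | As <- M] in
  red (rev Ps ++ G) (rp_elim (weaken 0 (size M) 0 t) M B (eps_args M))
    (rp_elim (weaken 0 (size M) 0 t') M B (eps_args M)) B.
Proof.
move=> ht Ps; have sz : size Ps = size M by rewrite size_map.
apply: red_rp_elim; first by rewrite -sz; apply: red_weaken_cat.
move=> k ltk; rewrite nth_mkseq //; set As := nth [::] M k.
apply: red_apps (reds_bvars _ _); apply: r_refl.
rewrite -sz weakenE; apply: t_var.
rewrite -[in X in onth _ X](size_rev As) onth_cat_add (onth_bvar _ (TVar 0)) ?sz //.
by rewrite (nth_map [::]).
Qed.

Lemma red_eps_inst G t t' M B :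
  red G t t' (All (rp_body M)) ->
  red G (eps_inst t M B) (eps_inst t' M B) (arrs [seq arrs As B | As <- M] B).
Proof.
move=> ht; case: B => [Y|C D|D] /=.
- by rewrite -tinst_rp_body; apply: r_tapp.
- by apply: red_lams; apply: red_eps_body.
- by apply: red_lams; apply: red_eps_body.
Qed.

Lemma tren_matrix_id M : tren_matrix id M = M.
Proof.
rewrite -[RHS]map_id; apply: eq_map => As; rewrite -[RHS]map_id.
by apply: eq_map => A; rewrite tren_id.
Qed.

(** Abstracting [v] over the <w_j> and applying the result to these same
    variables gives [v] back. *)
Lemma red_lams_bvars G As v B :
  typing (rev As ++ G) v B ->
  red (rev As ++ G) (apps (ren (addn (size As)) (lams As v)) (bvars (size As))) v B.
Proof.
move=> hv; rewrite renE inst_lams (eq_map tren_id) map_id.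
have e : inst id (msub (bvars (size As)))
    (inst id (ups (size As) (fun n => Var (size As + n))) v) = v.
  rewrite inst_comp -[RHS]inst_id; apply: inst_ext => // i.
  have szb : size (bvars (size As)) = size As by rewrite size_mkseq.
  have [lti|lei] := ltnP i (size As).
    rewrite ups_lt //= msub_lt szb // nth_bvars ?ltn_subrL ?(leq_ltn_trans _ lti) //.
    by rewrite /bvar subnSK // subKn // ltnW.
  by rewrite -(subnKC lei) ups_add /= -[in X in msub _ X]szb msub_add szb.
rewrite -[X in red _ _ X]e; apply: red_lams_apps (reds_bvars _ _).
have h : inst_typing id (fun n => Var (size As + n)) G (rev As ++ G).
  by move=> n C h; rewrite tren_id; apply: t_var; rewrite -(size_rev As) onth_cat_add.
by have := typing_inst (inst_typing_ups (As := As) h) hv; rewrite tren_id (eq_map tren_id) map_id.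
Qed.

(** Applying the epsilon-atomization of a type application to the branches of
    an elimination amounts, after the multiple beta-step for the y_k and those
    for the w_j in each branch, to pushing El_B inside the branches. *)
Lemma red_eps_inst_apps G t M B v :
  typing G t (All (rp_body M)) ->
  (forall k, k < size M -> typing (rev (nth [::] M k) ++ G) (v k) B) ->
  red G (apps (eps_inst t M B) (mkseq (fun k => lams (nth [::] M k) (v k)) (size M)))
    (rp_elim t M B (mkseq v (size M))) B.
Proof.
move=> ht hv; set us := mkseq _ _.
have hus : reds G us us [seq arrs As B | As <- M].
  apply: (reds_mkseq (x0 := [::])) => k ltk; apply: r_refl.
  by apply: typing_lams; apply: hv.
suff main : red G (apps (lams [seq arrs As B | As <- M]
    (rp_elim (weaken 0 (size M) 0 t) M B (eps_args M))) us)
    (rp_elim t M B (mkseq v (size M))) B.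
  (* At a type variable nothing is abstracted and both sides coincide. *)
  case: B hv @us hus main => // Y hv us hus _.
  have -> : rp_elim t M (TVar Y) (mkseq v (size M)) =
            apps (eps_inst t M (TVar Y)) us.
    rewrite /rp_elim /= weaken0.
    have -> : map (map (tshift 0)) M = M.
      by rewrite -[RHS]tren_matrix_id; do 2 apply: eq_map => ?; rewrite tshift0 tren_id.
    congr apps; apply/eq_in_map => k; rewrite mem_iota add0n => /= ltk.
    by rewrite nth_mkseq // weaken0.
  by apply: red_apps hus; apply: red_eps_inst; apply: r_refl.
have [hb _] := red_typing (red_eps_body B (r_refl ht)).
apply: r_trans (red_lams_apps hb hus) _.
(* The multiple beta-step leaves the terms (lambda <w_j>. v_k) <w_j> in the
   holes of El_B. *)
pose w k := let As := nth [::] M k in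
  apps (ren (addn (size As)) (lams As (v k))) (bvars (size As)).
have szu : size us = size M by rewrite size_mkseq.
rewrite (@inst_rp_elim _ _ _ _ _ _ (mkseq w (size M))); last first.
  move=> k ltk; rewrite !nth_mkseq // /w; set As := nth [::] M k.
  rewrite inst_apps inst_bvars_ups; congr apps.
  rewrite weakenE /= ups_add msub_lt szu ?ltn_subrL ?(leq_ltn_trans _ ltk) //.
  by rewrite subnSK // subKn ?(ltnW ltk) // nth_mkseq.
rewrite tren_matrix_id tren_id.
have -> : inst id (msub us) (weaken 0 (size M) 0 t) = t.
  rewrite weakenE inst_instV -[RHS]inst_id; apply: inst_ext => // i /=.
  by rewrite -szu msub_add.
apply: red_rp_elim; first exact: r_refl.
by move=> k ltk; rewrite !nth_mkseq //; apply: red_lams_bvars; apply: hv.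
Qed.

(** * Comparison of the two atomizations *)

(** By induction on [B].  The induction hypothesis turns the inner instantiation
    at the immediate subformula into its epsilon-atomization, whose application
    to the branches of the FF-atomization reduces by [red_eps_inst_apps]; the
    outcome is syntactically the epsilon-atomization at [B]. *)
Lemma red_ff_inst G t M B :
  typing G t (All (rp_body M)) ->
  red G (ff_inst t M B) (eps_inst t M B) (arrs [seq arrs As B | As <- M] B).
Proof.
elim: B G t M => [Y|C _ D IH|D IH] G t M ht /=.
- by rewrite -tinst_rp_body; apply: r_tapp; apply: r_refl.
- set Ps := [seq arrs As (Arr C D) | As <- M].
  have sz : size Ps = size M by rewrite size_map.
  apply: red_lams; rewrite -/(eps_args M).
  pose v k := let m := size (nth [::] M k) in
    App (apps (weaken 0 m.+1 0 (bvar (size M) k)) (bvars m)) (Var m).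
  rewrite (@rp_elim_Arr _ _ _ _ _ (mkseq v (size M))); last first.
    move=> k ltk; rewrite !nth_mkseq //= weaken_apps weaken_bvars.
    by rewrite /v /bvar !weakenE /= ltnNge leq_addr add1n addSn.
  rewrite weaken_weaken add1n; apply: r_lam.
  have ht' : typing (C :: rev Ps ++ G) (weaken 0 (size M).+1 0 t) (All (rp_body M)).
    have [] := red_typing (red_weaken_cat (rcons Ps C) (r_refl ht)).
    by rewrite size_rcons rev_rcons sz.
  have hv k : k < size M -> typing (rev (nth [::] M k) ++ C :: rev Ps ++ G) (v k) D.
    move=> ltk; rewrite /v; set As := nth [::] M k; apply: (@t_app _ C).
      suff /r_refl h : typing (rev As ++ C :: rev Ps ++ G)
          (weaken 0 (size As).+1 0 (bvar (size M) k)) (arrs As (Arr C D)).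
        by have [] := red_typing (red_apps h (reds_bvars _ _)).
      rewrite weakenE; apply: t_var; rewrite -[in X in onth _ X](size_rev As) addSnnS.
      rewrite onth_cat_add /= -sz (onth_bvar _ (TVar 0)) ?sz //.
      by rewrite (nth_map [::]).
    by apply: t_var; rewrite -(size_rev As) -[size _]addn0 onth_cat_add.
  apply: r_trans (red_eps_inst_apps ht' hv).
  apply: red_apps (IH _ _ _ ht') _; apply: (reds_mkseq (x0 := [::])) => k ltk.
  by apply: r_refl; apply: typing_lams; apply: hv.
- set Ps := [seq arrs As (All D) | As <- M].
  set M' := map (map (tshift 1)) M.
  have sz : size Ps = size M by rewrite size_map.
  have sz' : size M' = size M by rewrite size_map.
  apply: red_lams; rewrite -/(eps_args M).
  pose v k := let m := size (nth [::] M' k) in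
    TApp (apps (weaken 0 m 0 (bvar (size M') k)) (bvars m))
      (tren (upr succn) D) (TVar 0).
  rewrite (@rp_elim_All _ _ _ _ (mkseq v (size M'))); last first.
    move=> k ltk; rewrite !nth_mkseq ?sz' //= weaken_apps weaken_bvars /v.
    rewrite (nth_map [::]) // size_map.
    by rewrite sz' /bvar !weakenE /= ltnNge leq_addr.
  rewrite weaken_weaken add0n addn0 -/M' -sz'; apply: r_tlam.
  rewrite map_cat map_rev; set Ps' := map _ Ps.
  have szP : size Ps' = size M' by rewrite /Ps' size_map sz sz'.
  have ht' : typing (rev Ps' ++ map (tshift 1) G) (weaken 0 (size M') 1 t)
      (All (rp_body M')).
    have [] := red_typing (red_weaken_shift_cat Ps' (r_refl ht)).
    by rewrite szP /tshift /= tren_rp_body.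
  have hv k : k < size M' ->
      typing (rev (nth [::] M' k) ++ rev Ps' ++ map (tshift 1) G) (v k) D.
    move=> ltk; rewrite /v; set As := nth [::] M' k.
    have e : tinst 0 (tren (upr succn) D) = D.
      by rewrite /tinst tren_comp -[RHS]tren_id; apply: tren_ext => -[].
    rewrite -[X in typing _ _ X]e; apply: t_tapp.
    suff /r_refl h : typing (rev As ++ rev Ps' ++ map (tshift 1) G)
        (weaken 0 (size As) 0 (bvar (size M') k))
        (arrs As (All (tren (upr succn) D))).
      by have [] := red_typing (red_apps h (reds_bvars _ _)).
    rewrite weakenE; apply: t_var; rewrite -[in X in onth _ X](size_rev As).
    rewrite onth_cat_add -szP (onth_bvar _ (TVar 0)) ?szP //.
    rewrite sz' in ltk.
    rewrite (nth_map (TVar 0)) ?sz // (nth_map [::]) // /As (nth_map [::]) //.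
    by rewrite /tshift tren_arrs.
  apply: r_trans (red_eps_inst_apps ht' hv).
  apply: red_apps (IH _ _ _ ht') _; apply: (reds_mkseq (x0 := [::])) => k ltk.
  by apply: r_refl; apply: typing_lams; apply: hv.
Qed.

(** * The translations *)

Lemma ff_lams As t : ff (lams As t) = lams As (ff t).
Proof. by elim: As => //= A As ->. Qed.

Lemma eps_lams As t : eps (lams As t) = lams As (eps t).
Proof. by elim: As => //= A As ->. Qed.

Lemma ff_apps t us : ff (apps t us) = apps (ff t) (map ff us).
Proof. by elim: us t => //= u us IH t; rewrite IH. Qed.

Lemma eps_apps t us : eps (apps t us) = apps (eps t) (map eps us).
Proof. by elim: us t => //= u us IH t; rewrite IH. Qed.

Lemma size_matrix (T : Type) c (F : 'I_(nI c) -> T) : size (matrix F) = nK c.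
Proof. by rewrite size_map size_enum_ord. Qed.

Lemma nth_image_ord (T : Type) x0 n (f : 'I_n -> T) (k : 'I_n) :
  nth x0 [seq f i | i : 'I_n] k = f k.
Proof. by rewrite (nth_map k) ?size_enum_ord // nth_ord_enum. Qed.

Lemma mkseq_ord (T : Type) (f : nat -> T) n : mkseq f n = [seq f k | k : 'I_n].
Proof. by rewrite /mkseq -val_enum_ord -map_comp. Qed.

Lemma map_image_comp (T U : Type) (I : finType) (h : T -> U) (f : I -> T) :
  map h [seq f i | i : I] = [seq h (f i) | i : I].
Proof. exact: esym (map_comp _ _ _). Qed.

Lemma map_row (T U : Type) (h : T -> U) c (F : 'I_(nI c) -> T) k :
  map h (row F k) = row (h \o F) k.
Proof. by rewrite -map_comp. Qed.

Lemma tren_matrixE r c (F : 'I_(nI c) -> ty) :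
  tren_matrix r (matrix F) = matrix (tren r \o F).
Proof. by rewrite /tren_matrix -map_comp; apply: eq_map => k; apply: map_row. Qed.

Lemma inst_rp_intro r s M k ts :
  k < size M ->
  inst r s (rp_intro M k ts) = rp_intro (tren_matrix r M) k (map (inst r s) ts).
Proof.
move=> ltk; rewrite /rp_intro /= inst_lams inst_apps !size_map.
congr (TLam (lams _ (apps _ _))).
- rewrite -!map_comp; apply: eq_map => As /=.
  by rewrite tren_arrs map_tshift_upr.
- by rewrite /= ups_lt // ltn_subrL (leq_ltn_trans _ ltk).
- rewrite -!map_comp; apply: eq_map => t /=.
  rewrite !weakenE inst_instV instV_inst; apply: inst_ext => // i /=.
  by rewrite ups_add /tup renE rentE inst_instV.
Qed.

Lemma red_rp_intro G M k us us' :
  k < size M ->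
  let Ps := [seq arrs (map (tshift 1) As) (TVar 0) | As <- M] in
  reds (rev Ps ++ map (tshift 1) G) us us' (map (tshift 1) (nth [::] M k)) ->
  red G (TLam (lams Ps (apps (bvar (size M) k) us)))
    (TLam (lams Ps (apps (bvar (size M) k) us'))) (All (rp_body M)).
Proof.
move=> ltk Ps hus; apply: r_tlam; apply: red_lams; apply: red_apps hus.
have sz : size Ps = size M by rewrite size_map.
apply: r_refl; apply: t_var; rewrite -sz (onth_bvar _ (TVar 0)) ?sz //.
by rewrite (nth_map [::]).
Qed.

(** Substitutions of variables for variables. *)
Definition var_subst (s : nat -> tm) : Prop := forall n, exists m, s n = Var m.

Lemma var_subst_up s : var_subst s -> var_subst (up s).
Proof.
by move=> hs [|n] /=; [exists 0 | have [m ->] := hs n; exists m.+1].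
Qed.

Lemma var_subst_ups m s : var_subst s -> var_subst (ups m s).
Proof. by move=> hs; elim: m => //= m; apply: var_subst_up. Qed.

Lemma var_subst_weaken m d e s : var_subst s -> var_subst (fun i => weaken m d e (s i)).
Proof. by move=> hs i; have [n ->] := hs i; rewrite weakenE /=; eexists. Qed.

Lemma weaken_inst d e r s t :
  weaken 0 d e (inst r s t) = inst (addn e \o r) (fun i => weaken 0 d e (s i)) t.
Proof.
by rewrite weakenE instV_inst; apply: inst_ext => // i; rewrite weakenE.
Qed.

(** Both parts of the theorem, stated up to renaming: the RP-translation of an
    introduction weakens the translations of its arguments, so that the
    atomizations are taken of renamed translations. *)
Lemma red_translations G u A :
  ptyping G u A -> forall r s G',
  var_subst s -> inst_typing r s (map star G) G' ->
  red G' (ff (inst r s (star_tm u))) (eps (inst r s (star_tm u)))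
    (tren r (star A)) /\
  red G' (eps (inst r s (star_tm u))) (inst r s (sharp u)) (tren r (star A)).
Proof.
elim=> {G u A} [G n A e|G A B t _ IH|G A B t u _ IHt _ IHu
  |G c k A t _ IH|G c A C t b _ IHt _ IHb] r s G' hs h.
- have : typing G' (s n) (tren r (star A)) by apply: h; rewrite onth_map e.
  by have [m /= ->] := hs n => /r_refl; split.
- have [] := IH r (up s) (tren r (star A) :: G').
  + exact: var_subst_up.
  + exact: inst_typing_up h.
  by split; apply: r_lam.
- have [? ?] := IHt _ _ _ hs h; have [? ?] := IHu _ _ _ hs h.
  by split; apply: (@r_app _ (tren r (star A))).
- set F := fun i => star (A i).
  have [M [eM szM nthM]] : exists M, [/\ M = matrix (tren r \o F),
      size M = nK c & nth [::] M k = row (tren r \o F) k].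
    by exists (matrix (tren r \o F)); rewrite size_matrix nth_image_ord.
  have ltk : k < size M by rewrite szM.
  rewrite [star_tm _]/= [sharp _]/= [star _]/= -/F.
  rewrite !inst_rp_intro ?size_matrix // [tren _ _]/= tren_rp_body.
  rewrite -/(tren_matrix _ _) tren_matrixE -eM !map_image_comp.
  have h' : inst_typing (addn 1 \o r) (fun i => weaken 0 (size M) 1 (s i))
      (map star G)
      (rev [seq arrs (map (tshift 1) As) (TVar 0) | As <- M] ++ map (tshift 1) G').
    move=> i C /h /r_refl hi; rewrite -tren_comp.
    by have [] := red_typing (red_weaken_shift_cat
      [seq arrs (map (tshift 1) As) (TVar 0) | As <- M] hi); rewrite size_map.
  have IH' j := IH j _ _ _ (var_subst_weaken _ _ _ hs) h'.
  rewrite /rp_intro [ff _]/= [eps _]/= ff_lams eps_lams ff_apps eps_apps !map_image_comp.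
  rewrite -[ff (bvar _ _)]/(bvar _ _) -[eps (bvar _ _)]/(bvar _ _).
  split; apply: red_rp_intro => //; rewrite nthM /row map_image_comp.
    apply: reds_map => j _ /=; rewrite !weaken_inst /tshift tren_comp.
    by have [] := IH' j.
  apply: reds_map => j _ /=; rewrite !weaken_inst /tshift tren_comp.
  by have [] := IH' j.
- set F := fun i => star (A i).
  pose M := matrix (tren r \o F); have szM : size M = nK c := size_matrix _.
  rewrite [star_tm _]/= [sharp _]/= -/F.
  have [] := IHt _ _ _ hs h.
  rewrite /= -/F tren_rp_body -/(tren_matrix _ _) tren_matrixE -/M => t1 t2.
  set B := tren r (star C).
  pose ss k := ups (size (row F k)) s.
  have hb k : inst_typing r (ss k) (map star (rev (row A k) ++ G))
      (rev (row (tren r \o F) k) ++ G').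
    by have := inst_typing_ups (As := row F k) h; rewrite map_cat map_rev !map_row.
  have IHb' k := IHb k _ _ _ (var_subst_ups _ hs) (hb k).
  pose v := [seq inst r (ss k) (sharp (b k)) | k : 'I_(nK c)].
  rewrite (@inst_rp_elim _ _ _ _ _ _ v); last first.
    rewrite size_matrix => k ltk.
    by rewrite /v !(nth_image_ord _ _ (Ordinal ltk)).
  rewrite tren_matrixE -/M -/B inst_apps /= tren_rp_body -/(tren_matrix _ _).
  rewrite tren_matrixE -/M -/B ff_apps eps_apps /= rp_bodyK !map_image_comp.
  have [ht _] := red_typing t1; have [_ ht'] := red_typing t2.
  have eP : [seq arrs As B | As <- M] =
      [seq arrs (row (tren r \o F) k) B | k : 'I_(nK c)] by rewrite /M /matrix map_image_comp.
  split.
    apply: red_apps (r_trans (red_ff_inst _ ht) (red_eps_inst _ t1)) _.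
    rewrite eP; apply: reds_map => k _ /=.
    rewrite inst_lams ff_lams eps_lams map_row; apply: red_lams.
    by have [] := IHb' k.
  have hv k : k < size M -> typing (rev (nth [::] M k) ++ G') (nth (Var 0) v k) B.
    rewrite szM => ltk; rewrite /v /M !(nth_image_ord _ _ (Ordinal ltk)).
    by have [_ /red_typing[_]] := IHb' (Ordinal ltk).
  have szv : size v = size M by rewrite szM size_map size_enum_ord.
  rewrite -(mkseq_nth (Var 0) v) szv; apply: r_trans (red_eps_inst_apps ht' hv).
  apply: red_apps (red_eps_inst _ t2) _.
  rewrite szM mkseq_ord eP; apply: reds_map => k _ /=.
  rewrite inst_lams eps_lams map_row /M /v !nth_image_ord; apply: red_lams.
  by have [] := IHb' k.
Qed.

Theorem proposition16 (G : seq form) (A : form) (u : pterm)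
    (hu : ptyping G u A) :
  red (map star G) (ff (star_tm u)) (eps (star_tm u)) (star A) /\
  red (map star G) (eps (star_tm u)) (sharp u) (star A).
Proof.
have [] := @red_translations _ _ _ hu id Var (map star G).
- by move=> n; exists n.
- by move=> n B e; rewrite tren_id; apply: t_var.
by rewrite !inst_id tren_id.
Qed.
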